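(* In the Heisenberg group $\mathbb{H}^1$ let, for $1<p<\infty$ with $p\neq4$ and $L\in\mathbb{R}$, $$\eta=\frac{4-p}{4(1-p)}(1-L),\quad \tau=\frac{4-p}{4(1-p)}(1+L),\quad v=x_1^2+x_2^2-4iz,\quad w=x_1^2+x_2^2+4iz,\quad u_{p,L}=v^{\eta}w^{\tau}.$$ Then $\Delta_p u_{p,L}+iL[X_1,X_2]u_{p,L}$ need not be zero in $\mathbb{H}^1\setminus\{0\}$; that is, there exist $p\in(1,\infty)\setminus\{4\}$ and $L\in\mathbb{R}$ such that $\Delta_p u_{p,L}+iL[X_1,X_2]u_{p,L}$ is not identically zero on $\mathbb{H}^1\setminus\{0\}$.
   Context: $\mathbb{H}^1$ is $\mathbb{R}^3$ with coordinates $(x_1,x_2,z)$ and the vector fields $X_1=\frac{\partial}{\partial x_1}-\frac{x_2}{2}\frac{\partial}{\partial z}$, $X_2=\frac{\partial}{\partial x_2}+\frac{x_1}{2}\frac{\partial}{\partial z}$, so that $[X_1,X_2]=\frac{\partial}{\partial z}$. For a (complex-valued) function $u$, $\nabla_0u=(X_1u,X_2u)$, $\|\nabla_0u\|^2=X_1u\,\overline{X_1u}+X_2u\,\overline{X_2u}$, and the $p$-Laplacian is $\Delta_pu=X_1(\|\nabla_0u\|^{p-2}X_1u)+X_2(\|\nabla_0u\|^{p-2}X_2u)$. Complex powers are taken with the principal branch; $v$ and $w=\overline v$ have nonnegative real part and vanish only at the origin. *)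

(* Defs.v *)
From Stdlib Require Import Reals Lra.
From Coquelicot Require Import Coquelicot.

Open Scope R_scope.

(* Half-angle formula for the argument in (-PI, PI]; off the closed negative
   real axis Cmod z + Re z > 0.  The value at 0 is irrelevant. *)
Definition Carg (z : C) : R :=
  if Req_EM_T (Im z) 0 then (if Rlt_dec (Re z) 0 then PI else 0)
  else 2 * atan (Im z / (Cmod z + Re z)).

Definition Cexp (z : C) : C :=
  (exp (Re z) * cos (Im z), exp (Re z) * sin (Im z)).

Definition Clog (z : C) : C := (ln (Cmod z), Carg z).

(* Meaningful for z <> 0 only, as [ln 0] is a default value. *)
Definition Cpower (z a : C) : C := Cexp (Cmult a (Clog z)).

Lemma Carg_bound (z : C) : - PI < Carg z <= PI.
Proof.
  unfold Carg. pose proof PI_RGT_0 as HP.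
  destruct (Req_EM_T (Im z) 0) as [E|E].
  - destruct (Rlt_dec (Re z) 0); lra.
  - pose proof (atan_bound (Im z / (Cmod z + Re z))). lra.
Qed.

Lemma Carg_polar (z : C) :
  z = Cmult (RtoC (Cmod z)) (cos (Carg z), sin (Carg z)).
Proof.
  destruct z as [x y]. unfold Carg. simpl Re. simpl Im.
  destruct (Req_EM_T y 0) as [E|E].
  - subst y. replace (x, 0) with (RtoC x) by reflexivity. rewrite Cmod_R.
    destruct (Rlt_dec x 0) as [H|H].
    + rewrite cos_PI, sin_PI, Rabs_left by exact H.
      unfold Cmult, RtoC; simpl; f_equal; ring.
    + rewrite cos_0, sin_0, Rabs_right by lra.
      unfold Cmult, RtoC; simpl; f_equal; ring.
  - set (r := Cmod (x, y)).
    assert (Hr2 : r * r = x * x + y * y).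
    { unfold r, Cmod; simpl. rewrite sqrt_sqrt; nra. }
    assert (Hr : 0 <= r) by apply Cmod_ge_0.
    assert (Hy : 0 < y * y) by nra.
    assert (Hs : 0 < r + x) by nra.
    assert (Hr0 : 0 < r) by nra.
    set (t := y / (r + x)).
    assert (Ht : 1 + t * t = 2 * r / (r + x)).
    { unfold t. apply Rmult_eq_reg_r with ((r + x) * (r + x)); [|nra].
      transitivity ((r + x) * (r + x) + y * y); [field; lra|].
      transitivity (2 * r * (r + x)); [nra | field; lra]. }
    assert (Ht0 : 0 < 1 + t * t) by nra.
    assert (Hq : sqrt (1 + Rsqr t) * sqrt (1 + Rsqr t) = 1 + t * t).
    { rewrite sqrt_sqrt; unfold Rsqr; lra. }
    assert (Hq0 : 0 < sqrt (1 + Rsqr t)) by (apply sqrt_lt_R0; unfold Rsqr; lra).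
    rewrite sin_2a, cos_2a, cos_atan, sin_atan.
    set (q := sqrt (1 + Rsqr t)) in *.
    replace (1 / q * (1 / q) - t / q * (t / q)) with ((1 - t * t) / (q * q))
      by (field; lra).
    replace (2 * (t / q) * (1 / q)) with (2 * t / (q * q)) by (field; lra).
    rewrite Hq.
    assert (Hc : r * ((1 - t * t) / (1 + t * t)) = x).
    { replace (1 - t * t) with (2 - (1 + t * t)) by ring. rewrite Ht.
      field. lra. }
    assert (Hsn : r * (2 * t / (1 + t * t)) = y).
    { rewrite Ht. unfold t. field. lra. }
    unfold Cmult, RtoC; simpl. f_equal; nra.
Qed.

Definition H1 : Type := (R * R * R)%type.

Definition H1_origin : H1 := (0, 0, 0).

Definition ex_deriveC (f : R -> C) (t : R) : Prop :=
  ex_derive (fun s => Re (f s)) t /\ ex_derive (fun s => Im (f s)) t.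

(* Meaningful under [ex_deriveC f t] only. *)
Definition DeriveC (f : R -> C) (t : R) : C :=
  (Derive (fun s => Re (f s)) t, Derive (fun s => Im (f s)) t).

Definition d_x1 (f : H1 -> C) (q : H1) : C :=
  let '(x1, x2, z) := q in DeriveC (fun t => f (t, x2, z)) x1.
Definition d_x2 (f : H1 -> C) (q : H1) : C :=
  let '(x1, x2, z) := q in DeriveC (fun t => f (x1, t, z)) x2.
Definition d_z (f : H1 -> C) (q : H1) : C :=
  let '(x1, x2, z) := q in DeriveC (fun t => f (x1, x2, t)) z.

Definition ex_partials (f : H1 -> C) (q : H1) : Prop :=
  let '(x1, x2, z) := q in
  ex_deriveC (fun t => f (t, x2, z)) x1 /\
  ex_deriveC (fun t => f (x1, t, z)) x2 /\
  ex_deriveC (fun t => f (x1, x2, t)) z.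

Definition X1 (f : H1 -> C) (q : H1) : C :=
  let '(x1, x2, z) := q in
  Cminus (d_x1 f q) (Cmult (RtoC (x2 / 2)) (d_z f q)).

Definition X2 (f : H1 -> C) (q : H1) : C :=
  let '(x1, x2, z) := q in
  Cplus (d_x2 f q) (Cmult (RtoC (x1 / 2)) (d_z f q)).

Definition bracket_X1_X2 (f : H1 -> C) (q : H1) : C :=
  Cminus (X1 (X2 f) q) (X2 (X1 f) q).

Definition grad0_norm (f : H1 -> C) (q : H1) : R :=
  sqrt (Re (Cplus (Cmult (X1 f q) (Cconj (X1 f q)))
                  (Cmult (X2 f q) (Cconj (X2 f q))))).

(* [Rpower 0 a] is a default value, but where the norm vanishes so does X1 f:
   the product is then 0, which is the continuous extension for p > 1. *)
Definition flux1 (p : R) (f : H1 -> C) (q : H1) : C :=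
  Cmult (RtoC (Rpower (grad0_norm f q) (p - 2))) (X1 f q).
Definition flux2 (p : R) (f : H1 -> C) (q : H1) : C :=
  Cmult (RtoC (Rpower (grad0_norm f q) (p - 2))) (X2 f q).

Definition pLaplacian (p : R) (f : H1 -> C) (q : H1) : C :=
  Cplus (X1 (flux1 p f) q) (X2 (flux2 p f) q).

Definition drift_operator (p L : R) (f : H1 -> C) (q : H1) : C :=
  Cplus (pLaplacian p f q) (Cmult (Cmult Ci (RtoC L)) (bracket_X1_X2 f q)).

(* All derivatives occurring in [drift_operator p L f q] exist, so that none of
   them is a default value of [Derive]. *)
Definition drift_defined (p : R) (f : H1 -> C) (q : H1) : Prop :=
  locally q (ex_partials f) /\
  ex_partials (X1 f) q /\ ex_partials (X2 f) q /\
  ex_partials (flux1 p f) q /\ ex_partials (flux2 p f) q.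

Definition eta (p L : R) : R := (4 - p) / (4 * (1 - p)) * (1 - L).
Definition tau (p L : R) : R := (4 - p) / (4 * (1 - p)) * (1 + L).

Definition v (q : H1) : C :=
  let '(x1, x2, z) := q in
  Cminus (RtoC (x1 ^ 2 + x2 ^ 2)) (Cmult (Cmult (RtoC 4) Ci) (RtoC z)).
Definition w (q : H1) : C :=
  let '(x1, x2, z) := q in
  Cplus (RtoC (x1 ^ 2 + x2 ^ 2)) (Cmult (Cmult (RtoC 4) Ci) (RtoC z)).

Definition u (p L : R) (q : H1) : C :=
  Cmult (Cpower (v q) (RtoC (eta p L))) (Cpower (w q) (RtoC (tau p L))).

(* Main.v *)
Require Import Defs.
From Stdlib Require Import Reals Lra.
From Coquelicot Require Import Coquelicot.
Open Scope R_scope.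

(** The two terms of the operator scale differently under the Heisenberg
    dilations (x1, x2, z) |-> (s x1, s x2, s^2 z).  The function u_{p,L} is
    homogeneous of degree d = (4 - p) / (1 - p), so Delta_p u has degree
    (p - 1)(d - 1) - 1 = -4, while [X1, X2] u has degree
    d - 2 = (p + 2) / (1 - p).  These agree only for p = 2; for any other p the
    sum can vanish on a whole dilation orbit only if both terms do.

    A concrete instance is p = 8/5, L = 1.  There eta = 0 and tau = -2, so that
    u = w^(-2) is rational ([u_rational]).  With zeta' = x1 - i x2 one has
    X1 w = 2 zeta' and X2 w = i X1 w, whence X1 u = -4 zeta' / w^3 and
    X2 u = i X1 u ([X1_u], [X2_u]).  The horizontal gradient has
    squared norm 32 |zeta'|^2 / |w|^6 ([grad0_norm_u]), and so the weight in
    the p-Laplacian is its (-1/5)-th power ([weight_u]).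

    Along the points (s, 0, 0), s > 0, this gives Delta_p u = -8 s^(-4) and
    i L [X1, X2] u = 8 s^(-6), which cancel exactly for s = 1.  The witness is
    the point s = 2, where the weight and its derivatives are still rational:
    the operator takes the value -1/2 + 1/8 = -3/8. *)

(** * Complex exponentials *)

Lemma Cexp_plus (a b : C) : Cexp (a + b)%C = (Cexp a * Cexp b)%C.
Proof.
  destruct a as [a1 a2], b as [b1 b2]; unfold Cexp, Cmult; simpl.
  rewrite exp_plus, cos_plus, sin_plus; f_equal; ring.
Qed.

Lemma Cexp_0 : Cexp (RtoC 0) = RtoC 1.
Proof.
  unfold Cexp, RtoC; simpl; rewrite exp_0, cos_0, sin_0; f_equal; ring.
Qed.

Lemma Cexp_Clog (z : C) : z <> RtoC 0 -> Cexp (Clog z) = z.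
Proof.
  intros Hz; rewrite (Carg_polar z) at 2.
  unfold Cexp, Clog; simpl.
  rewrite exp_ln by (apply Cmod_gt_0; exact Hz).
  unfold Cmult, RtoC; simpl; f_equal; ring.
Qed.

Lemma Cpower_0 (z : C) : Cpower z (RtoC 0) = RtoC 1.
Proof.
  unfold Cpower; rewrite Cmult_0_l; exact Cexp_0.
Qed.

Lemma Cpower_m2 (z : C) :
  z <> RtoC 0 -> Cpower z (RtoC (-2)) = (/ (z * z))%C.
Proof.
  intros Hz.
  assert (H : (Cpower z (RtoC (-2)) * (z * z))%C = RtoC 1).
  { rewrite <- (Cexp_Clog z Hz) at 2 3.
    unfold Cpower; rewrite <- !Cexp_plus.
    replace (RtoC (-2) * Clog z + (Clog z + Clog z))%C with (RtoC 0).
    - exact Cexp_0.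
    - destruct (Clog z) as [a b]; unfold Cmult, Cplus, RtoC; simpl;
        f_equal; ring. }
  assert (Hzz : (z * z)%C <> RtoC 0) by (apply Cmult_neq_0; exact Hz).
  rewrite <- (Cmult_1_l (/ (z * z))%C), <- H.
  field; exact Hz.
Qed.

(** * Differentiation of complex-valued functions *)

Definition is_deriveC (f : R -> C) (t : R) (l : C) : Prop :=
  is_derive (fun s => Re (f s)) t (Re l) /\
  is_derive (fun s => Im (f s)) t (Im l).

Lemma is_deriveC_ex (f : R -> C) (t : R) (l : C) :
  is_deriveC f t l -> ex_deriveC f t.
Proof. intros [H1 H2]; split; eexists; eassumption. Qed.

Lemma is_deriveC_unique (f : R -> C) (t : R) (l : C) :
  is_deriveC f t l -> DeriveC f t = l.
Proof.
  intros [H1 H2]; apply injective_projections; now apply is_derive_unique.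
Qed.

Lemma is_deriveC_ext_loc (f g : R -> C) (t : R) (l : C) :
  locally t (fun s => f s = g s) -> is_deriveC f t l -> is_deriveC g t l.
Proof.
  intros E [H1 H2]; split; (eapply is_derive_ext_loc; [|eassumption]);
    (eapply filter_imp; [|exact E]); intros s Hs; simpl; now rewrite Hs.
Qed.

Lemma is_deriveC_RtoC (f : R -> R) (t l : R) :
  is_derive f t l -> is_deriveC (fun s => RtoC (f s)) t (RtoC l).
Proof.
  intros H; split; simpl; [exact H | now auto_derive].
Qed.

Lemma is_deriveC_mult (f g : R -> C) (t : R) (a b : C) :
  is_deriveC f t a -> is_deriveC g t b ->
  is_deriveC (fun s => (f s * g s)%C) t (a * g t + f t * b)%C.
Proof.
  intros [F1 F2] [G1 G2].
  set (f1 := fun s => Re (f s)) in *; set (f2 := fun s => Im (f s)) in *.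
  set (g1 := fun s => Re (g s)) in *; set (g2 := fun s => Im (g s)) in *.
  assert (UF1 : Derive (fun s => f1 s) t = Re a)
    by now apply is_derive_unique.
  assert (UF2 : Derive (fun s => f2 s) t = Im a)
    by now apply is_derive_unique.
  assert (UG1 : Derive (fun s => g1 s) t = Re b)
    by now apply is_derive_unique.
  assert (UG2 : Derive (fun s => g2 s) t = Im b)
    by now apply is_derive_unique.
  split.
  - apply (is_derive_ext (fun s => f1 s * g1 s - f2 s * g2 s)); [reflexivity|].
    auto_derive.
    + repeat split; eexists; eassumption.
    + rewrite UF1, UF2, UG1, UG2; unfold f1, f2, g1, g2, Re, Im; simpl; ring.
  - apply (is_derive_ext (fun s => f1 s * g2 s + f2 s * g1 s)); [reflexivity|].
    auto_derive.
    + repeat split; eexists; eassumption.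
    + rewrite UF1, UF2, UG1, UG2; unfold f1, f2, g1, g2, Re, Im; simpl; ring.
Qed.

Lemma Cneq_0_sqr (z : C) : z <> RtoC 0 -> Re z * Re z + Im z * Im z <> 0.
Proof.
  intros Hz H; apply Hz; destruct z as [x y]; simpl in H.
  assert (x = 0) by nra; assert (y = 0) by nra; now subst.
Qed.

Lemma is_deriveC_inv (f : R -> C) (t : R) (a : C) :
  f t <> RtoC 0 -> is_deriveC f t a ->
  is_deriveC (fun s => (/ f s)%C) t (- a * / (f t * f t))%C.
Proof.
  intros Hf [F1 F2]; apply Cneq_0_sqr in Hf.
  set (f1 := fun s => Re (f s)) in *; set (f2 := fun s => Im (f s)) in *.
  change (f1 t * f1 t + f2 t * f2 t <> 0) in Hf.
  assert (UF1 : Derive (fun s => f1 s) t = Re a)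
    by now apply is_derive_unique.
  assert (UF2 : Derive (fun s => f2 s) t = Im a)
    by now apply is_derive_unique.
  (* the denominator in the inverse of [f t * f t] is its squared norm, that
     is, the square of the squared norm of [f t] *)
  assert (Hff : (f1 t * f1 t - f2 t * f2 t) * (f1 t * f1 t - f2 t * f2 t)
                + (f1 t * f2 t + f2 t * f1 t) * (f1 t * f2 t + f2 t * f1 t)
                <> 0).
  { match goal with |- ?e <> 0 =>
      replace e with ((f1 t * f1 t + f2 t * f2 t) ^ 2) by ring end.
    now apply pow_nonzero. }
  split.
  - apply (is_derive_ext (fun s => f1 s / (f1 s * f1 s + f2 s * f2 s))).
    { intros s; unfold Cinv, f1, f2, Re, Im; simpl; f_equal; ring. }
    auto_derive.
    + repeat split; try (eexists; eassumption); assumption.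
    + rewrite UF1, UF2; simpl.
      change (fst (f t)) with (f1 t); change (snd (f t)) with (f2 t).
      unfold Re, Im.
      field; split; assumption.
  - apply (is_derive_ext (fun s => - f2 s / (f1 s * f1 s + f2 s * f2 s))).
    { intros s; unfold Cinv, f1, f2, Re, Im; simpl; f_equal; ring. }
    auto_derive.
    + repeat split; try (eexists; eassumption); assumption.
    + rewrite UF1, UF2; simpl.
      change (fst (f t)) with (f1 t); change (snd (f t)) with (f2 t).
      unfold Re, Im.
      field; split; assumption.
Qed.

(** * Partial derivatives on the Heisenberg group *)

Definition has_partials (f : H1 -> C) (q : H1) (a b c : C) : Prop :=
  let '(x1, x2, z) := q in
  is_deriveC (fun t => f (t, x2, z)) x1 a /\
  is_deriveC (fun t => f (x1, t, z)) x2 b /\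
  is_deriveC (fun t => f (x1, x2, t)) z c.

Lemma has_partials_ex (f : H1 -> C) (q : H1) (a b c : C) :
  has_partials f q a b c -> ex_partials f q.
Proof.
  destruct q as [[x1 x2] z]; intros (A & B & D).
  split; [|split]; eapply is_deriveC_ex; eassumption.
Qed.

Lemma has_partials_X1 (f : H1 -> C) (x1 x2 z : R) (a b c : C) :
  has_partials f (x1, x2, z) a b c ->
  X1 f (x1, x2, z) = (a - RtoC (x2 / 2) * c)%C.
Proof.
  intros (A & B & D); unfold X1, d_x1, d_z.
  now rewrite (is_deriveC_unique _ _ _ A), (is_deriveC_unique _ _ _ D).
Qed.

Lemma has_partials_X2 (f : H1 -> C) (x1 x2 z : R) (a b c : C) :
  has_partials f (x1, x2, z) a b c ->
  X2 f (x1, x2, z) = (b + RtoC (x1 / 2) * c)%C.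
Proof.
  intros (A & B & D); unfold X2, d_x2, d_z.
  now rewrite (is_deriveC_unique _ _ _ B), (is_deriveC_unique _ _ _ D).
Qed.

Lemma has_partials_ext_loc (f g : H1 -> C) (q : H1) (a b c : C) :
  locally q (fun r => f r = g r) ->
  has_partials f q a b c -> has_partials g q a b c.
Proof.
  destruct q as [[x1 x2] z]; intros [eps E] (A & B & D).
  split; [|split];
    (eapply is_deriveC_ext_loc;
       [exists eps; intros y Hy; apply E | eassumption]);
    (split; [split|]); simpl; try exact Hy; apply ball_center.
Qed.

Lemma has_partials_eq (f : H1 -> C) (q : H1) (a b c a' b' c' : C) :
  has_partials f q a b c -> a = a' -> b = b' -> c = c' ->
  has_partials f q a' b' c'.
Proof. now intros H <- <- <-. Qed.

Lemma has_partials_const (k : C) (q : H1) :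
  has_partials (fun _ => k) q (RtoC 0) (RtoC 0) (RtoC 0).
Proof.
  destruct q as [[x1 x2] z]; split; [|split]; split; simpl; now auto_derive.
Qed.

Lemma has_partials_mult (f g : H1 -> C) (q : H1) (a b c a' b' c' : C) :
  has_partials f q a b c -> has_partials g q a' b' c' ->
  has_partials (fun r => (f r * g r)%C) q
    (a * g q + f q * a')%C (b * g q + f q * b')%C (c * g q + f q * c')%C.
Proof.
  destruct q as [[x1 x2] z]; intros (A & B & D) (A' & B' & D').
  split; [|split].
  - exact (is_deriveC_mult _ _ _ _ _ A A').
  - exact (is_deriveC_mult _ _ _ _ _ B B').
  - exact (is_deriveC_mult _ _ _ _ _ D D').
Qed.

Lemma has_partials_Ci_mult (f : H1 -> C) (q : H1) (a b c : C) :
  has_partials f q a b c ->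
  has_partials (fun r => (Ci * f r)%C) q (Ci * a)%C (Ci * b)%C (Ci * c)%C.
Proof.
  intros H.
  pose proof (has_partials_mult _ _ _ _ _ _ _ _ _ (has_partials_const Ci q) H)
    as K.
  rewrite !Cmult_0_l, !Cplus_0_l in K; exact K.
Qed.

Lemma has_partials_inv (f : H1 -> C) (q : H1) (a b c : C) :
  f q <> RtoC 0 -> has_partials f q a b c ->
  has_partials (fun r => (/ f r)%C) q
    (- a * / (f q * f q))%C (- b * / (f q * f q))%C (- c * / (f q * f q))%C.
Proof.
  destruct q as [[x1 x2] z]; intros Hf (A & B & D).
  split; [|split].
  - exact (is_deriveC_inv (fun t => f (t, x2, z)) _ _ Hf A).
  - exact (is_deriveC_inv (fun t => f (x1, t, z)) _ _ Hf B).
  - exact (is_deriveC_inv (fun t => f (x1, x2, t)) _ _ Hf D).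
Qed.

(** * The function w^(-2) and its horizontal gradient *)

Definition zeta_conj (q : H1) : C := let '(x1, x2, _) := q in (x1, - x2).

Lemma has_partials_zeta_conj (q : H1) :
  has_partials zeta_conj q (RtoC 1) (- Ci)%C (RtoC 0).
Proof.
  destruct q as [[x1 x2] z]; split; [|split]; split; simpl; auto_derive;
    trivial; ring.
Qed.

Lemma has_partials_w (x1 x2 z : R) :
  has_partials w (x1, x2, z)
    (RtoC (2 * x1)) (RtoC (2 * x2)) (RtoC 4 * Ci)%C.
Proof.
  split; [|split]; split; simpl; auto_derive; trivial; ring.
Qed.

Lemma w_neq_0 (x1 x2 z : R) : 0 < x1 -> w (x1, x2, z) <> RtoC 0.
Proof.
  intros Hx H; apply (f_equal Re) in H; simpl in H; nra.
Qed.

Lemma u_rational (x1 x2 z : R) :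
  0 < x1 ->
  u (8 / 5) 1 (x1, x2, z) = (/ (w (x1, x2, z) * w (x1, x2, z)))%C.
Proof.
  intros Hx; unfold u.
  replace (eta (8 / 5) 1) with 0 by (unfold eta; field).
  replace (tau (8 / 5) 1) with (-2) by (unfold tau; field).
  rewrite Cpower_0, Cpower_m2 by now apply w_neq_0.
  apply Cmult_1_l.
Qed.

(** The half-space x1 > 0 is open and misses the origin, so identities proved
    on it may be differentiated at each of its points. *)
Lemma locally_halfspace (P : H1 -> Prop) (x1 x2 z : R) :
  0 < x1 ->
  (forall y1 y2 y3, 0 < y1 -> P (y1, y2, y3)) ->
  locally ((x1, x2, z) : H1) P.
Proof.
  intros Hx HP; exists (mkposreal x1 Hx).
  intros [[y1 y2] y3] [[B _] _]; apply HP.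
  apply Rabs_lt_between' in B; simpl in B; lra.
Qed.

Lemma has_partials_u (x1 x2 z : R) :
  0 < x1 ->
  let W := w (x1, x2, z) in
  has_partials (u (8 / 5) 1) (x1, x2, z)
    (RtoC (-4 * x1) / (W * W * W))%C
    (RtoC (-4 * x2) / (W * W * W))%C
    (RtoC (-8) * Ci / (W * W * W))%C.
Proof.
  intros Hx W.
  pose proof (w_neq_0 x1 x2 z Hx) as HW; fold W in HW.
  apply (has_partials_ext_loc (fun q => (/ (w q * w q))%C)).
  - apply locally_halfspace; [exact Hx|].
    intros; symmetry; now apply u_rational.
  - pose proof (has_partials_w x1 x2 z) as D.
    pose proof (has_partials_mult _ _ _ _ _ _ _ _ _ D D) as DD.
    apply has_partials_inv in DD; [|now apply Cmult_neq_0].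
    fold W in DD.
    assert (K : forall k l : C, l = (- (RtoC 2) * k)%C ->
      (- (k * W + W * k) * / (W * W * (W * W)))%C = (l / (W * W * W))%C).
    { intros k l ->; field; exact HW. }
    rewrite (K _ (RtoC (-4 * x1))) in DD
      by (unfold RtoC, Cmult, Copp; simpl; f_equal; ring).
    rewrite (K _ (RtoC (-4 * x2))) in DD
      by (unfold RtoC, Cmult, Copp; simpl; f_equal; ring).
    rewrite (K _ (RtoC (-8) * Ci)%C) in DD
      by (unfold RtoC, Ci, Cmult, Copp; simpl; f_equal; ring).
    exact DD.
Qed.

(** Since X2 w = i X1 w, one function carries both components of the horizontal
    gradient: X1 u is this one, and X2 u is i times it. *)
Definition grad_u (q : H1) : C :=
  (RtoC (-4) * zeta_conj q * / (w q * (w q * w q)))%C.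

Lemma X1_u (x1 x2 z : R) :
  0 < x1 -> X1 (u (8 / 5) 1) (x1, x2, z) = grad_u (x1, x2, z).
Proof.
  intros Hx.
  rewrite (has_partials_X1 _ _ _ _ _ _ _ (has_partials_u x1 x2 z Hx)).
  pose proof (w_neq_0 x1 x2 z Hx) as HW.
  unfold grad_u; generalize dependent (w (x1, x2, z)); intros W HW.
  replace (zeta_conj (x1, x2, z)) with (RtoC x1 - RtoC x2 * Ci)%C
    by (unfold zeta_conj, RtoC, Ci, Cmult, Cminus, Cplus, Copp; simpl;
        f_equal; ring).
  replace (RtoC (-4 * x1)) with (RtoC (-4) * RtoC x1)%C
    by (symmetry; apply RtoC_mult).
  replace (RtoC (x2 / 2) * (RtoC (-8) * Ci / (W * W * W)))%C
    with (RtoC (-4) * RtoC x2 * Ci / (W * W * W))%C.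
  - field; exact HW.
  - unfold Cdiv; rewrite !Cmult_assoc.
    replace (RtoC (x2 / 2) * RtoC (-8))%C with (RtoC (-4) * RtoC x2)%C;
      [reflexivity | rewrite <- !RtoC_mult; f_equal; field].
Qed.

Lemma X2_u (x1 x2 z : R) :
  0 < x1 -> X2 (u (8 / 5) 1) (x1, x2, z) = (Ci * grad_u (x1, x2, z))%C.
Proof.
  intros Hx.
  rewrite (has_partials_X2 _ _ _ _ _ _ _ (has_partials_u x1 x2 z Hx)).
  pose proof (w_neq_0 x1 x2 z Hx) as HW.
  unfold grad_u; generalize dependent (w (x1, x2, z)); intros W HW.
  unfold Cdiv.
  replace (W * (W * W))%C with (W * W * W)%C by ring.
  generalize (/ (W * W * W))%C; intros V; destruct V.
  unfold zeta_conj, RtoC, Ci, Cmult, Cplus; simpl; f_equal; field.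
Qed.

Definition grad_u_norm2 (q : H1) : R :=
  let '(x1, x2, z) := q in
  32 * (x1 * x1 + x2 * x2)
    / ((x1 * x1 + x2 * x2) * (x1 * x1 + x2 * x2) + 16 * (z * z)) ^ 3.

Lemma grad_u_norm2_pos (x1 x2 z : R) : 0 < x1 -> 0 < grad_u_norm2 (x1, x2, z).
Proof.
  intros Hx; unfold grad_u_norm2; apply Rdiv_lt_0_compat; [nra | apply pow_lt].
  assert (0 < x1 * x1 + x2 * x2) by nra; nra.
Qed.

Lemma Cmod_sqr (z : C) : Cmod z ^ 2 = Re z * Re z + Im z * Im z.
Proof.
  unfold Cmod, Re, Im; rewrite pow2_sqrt by nra; ring.
Qed.

Lemma grad0_norm_u (x1 x2 z : R) :
  0 < x1 ->
  grad0_norm (u (8 / 5) 1) (x1, x2, z) = sqrt (grad_u_norm2 (x1, x2, z)).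
Proof.
  intros Hx; unfold grad0_norm; f_equal.
  rewrite X1_u, X2_u by exact Hx.
  transitivity (2 * Cmod (grad_u (x1, x2, z)) ^ 2).
  - rewrite Cmod_sqr; destruct (grad_u (x1, x2, z)) as [a b].
    unfold Ci, Cconj, Cmult, Cplus; simpl; ring.
  - pose proof (w_neq_0 x1 x2 z Hx) as HW.
    assert (Hw0 : Cmod (w (x1, x2, z)) <> 0)
      by (apply Rgt_not_eq, Cmod_gt_0; exact HW).
    assert (Hw : Cmod (w (x1, x2, z)) ^ 2
      = (x1 * x1 + x2 * x2) * (x1 * x1 + x2 * x2) + 16 * (z * z))
      by (rewrite Cmod_sqr; simpl; ring).
    assert (Hz : Cmod (zeta_conj (x1, x2, z)) ^ 2 = x1 * x1 + x2 * x2)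
      by (rewrite Cmod_sqr; simpl; ring).
    assert (H4 : Cmod (RtoC (-4)) ^ 2 = 16)
      by (rewrite Cmod_sqr; simpl; ring).
    unfold grad_u, grad_u_norm2.
    rewrite !Cmod_mult, Cmod_inv, !Cmod_mult
      by (repeat apply Cmult_neq_0; exact HW).
    rewrite <- Hw, <- Hz.
    rewrite !Rpow_mult_distr, H4; field; exact Hw0.
Qed.

Definition weight (q : H1) : R := Rpower (grad_u_norm2 q) (- (1 / 5)).

Lemma weight_u (x1 x2 z : R) :
  0 < x1 ->
  Rpower (grad0_norm (u (8 / 5) 1) (x1, x2, z)) (8 / 5 - 2)
  = weight (x1, x2, z).
Proof.
  intros Hx; rewrite grad0_norm_u by exact Hx.
  rewrite <- Rpower_sqrt by now apply grad_u_norm2_pos.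
  rewrite Rpower_mult; unfold weight; f_equal; field.
Qed.

(** * Values at the point (2, 0, 0) *)

Definition q0 : H1 := (2, 0, 0).

(** At (2, 0, 0) the squared norm is 1/32, a perfect fifth power, so that its
    (-1/5)-th power is rational. *)
Lemma weight_q0 : weight q0 = 2.
Proof.
  unfold weight.
  replace (grad_u_norm2 q0) with (Rpower 2 (- INR 5)).
  - rewrite Rpower_mult; replace (- INR 5 * - (1 / 5)) with 1 by (simpl; field).
    apply Rpower_1; lra.
  - rewrite Rpower_Ropp, Rpower_pow by lra.
    unfold grad_u_norm2, q0; simpl; field.
Qed.

(** The squared norm is even in x2 and in z, which leaves the x1-derivative; on
    the positive x1-axis the weight is x1^2 / 2. *)
Lemma has_partials_weight :
  has_partials (fun q => RtoC (weight q)) q0 (RtoC 2) (RtoC 0) (RtoC 0).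
Proof.
  unfold q0; split; [|split]; apply is_deriveC_RtoC;
    unfold weight, Rpower, grad_u_norm2; auto_derive.
  all: try (simpl; repeat split; try apply Rdiv_lt_0_compat; lra).
  (* the exponential left by the chain rule is the weight itself *)
  all: match goal with |- context [exp ?e] =>
    change (exp e) with (weight q0); rewrite weight_q0 end.
  all: field.
Qed.

Lemma w_q0 : w q0 = RtoC 4.
Proof.
  unfold w, q0, RtoC, Ci, Cmult, Cplus; simpl; f_equal; ring.
Qed.

Lemma zeta_conj_q0 : zeta_conj q0 = RtoC 2.
Proof. unfold zeta_conj, q0, RtoC; f_equal; ring. Qed.

Lemma has_partials_grad_u :
  has_partials grad_u q0 (RtoC (5 / 16)) (RtoC (1 / 16) * Ci)%C
    (RtoC (3 / 8) * Ci)%C.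
Proof.
  pose proof (has_partials_w 2 0 0 : has_partials w q0 _ _ _) as W.
  assert (HW : w q0 <> RtoC 0) by (apply w_neq_0; lra).
  pose proof (has_partials_mult _ _ _ _ _ _ _ _ _ W W) as WW.
  pose proof (has_partials_mult _ _ _ _ _ _ _ _ _ W WW) as W3.
  apply has_partials_inv in W3; [|repeat apply Cmult_neq_0; exact HW].
  pose proof (has_partials_mult _ _ _ _ _ _ _ _ _
    (has_partials_mult _ _ _ _ _ _ _ _ _
      (has_partials_const (RtoC (-4)) q0) (has_partials_zeta_conj q0)) W3) as H.
  apply (has_partials_eq _ _ _ _ _ _ _ _ H).
  all: rewrite w_q0, zeta_conj_q0, <- !RtoC_mult, <- !RtoC_inv by lra.
  all: unfold RtoC, Ci, Cmult, Cplus, Copp; simpl; f_equal; field.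
Qed.

Lemma grad_u_q0 : grad_u q0 = RtoC (- (1 / 8)).
Proof.
  unfold grad_u; rewrite w_q0, zeta_conj_q0.
  rewrite <- !RtoC_mult, <- RtoC_inv, <- RtoC_mult by lra.
  f_equal; field.
Qed.

Lemma has_partials_X1_u :
  has_partials (X1 (u (8 / 5) 1)) q0 (RtoC (5 / 16)) (RtoC (1 / 16) * Ci)%C
    (RtoC (3 / 8) * Ci)%C.
Proof.
  eapply has_partials_ext_loc; [|exact has_partials_grad_u].
  apply locally_halfspace; [lra|]; intros; symmetry; now apply X1_u.
Qed.

Lemma has_partials_X2_u :
  has_partials (X2 (u (8 / 5) 1)) q0 (Ci * RtoC (5 / 16))%C
    (Ci * (RtoC (1 / 16) * Ci))%C (Ci * (RtoC (3 / 8) * Ci))%C.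
Proof.
  eapply has_partials_ext_loc;
    [|exact (has_partials_Ci_mult _ _ _ _ _ has_partials_grad_u)].
  apply locally_halfspace; [lra|]; intros; symmetry; now apply X2_u.
Qed.

Lemma has_partials_flux :
  has_partials (fun q => RtoC (weight q) * grad_u q)%C q0
    (RtoC (3 / 8)) (RtoC (1 / 8) * Ci)%C (RtoC (3 / 4) * Ci)%C.
Proof.
  pose proof (has_partials_mult _ _ _ _ _ _ _ _ _
    has_partials_weight has_partials_grad_u) as H.
  apply (has_partials_eq _ _ _ _ _ _ _ _ H).
  all: rewrite grad_u_q0, weight_q0.
  all: unfold RtoC, Ci, Cmult, Cplus; simpl; f_equal; field.
Qed.

Lemma has_partials_flux1 :
  has_partials (flux1 (8 / 5) (u (8 / 5) 1)) q0
    (RtoC (3 / 8)) (RtoC (1 / 8) * Ci)%C (RtoC (3 / 4) * Ci)%C.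
Proof.
  eapply has_partials_ext_loc; [|exact has_partials_flux].
  apply locally_halfspace; [lra|]; intros; unfold flux1.
  now rewrite weight_u, X1_u.
Qed.

Lemma has_partials_flux2 :
  has_partials (flux2 (8 / 5) (u (8 / 5) 1)) q0
    (Ci * RtoC (3 / 8))%C (Ci * (RtoC (1 / 8) * Ci))%C
    (Ci * (RtoC (3 / 4) * Ci))%C.
Proof.
  eapply has_partials_ext_loc;
    [|exact (has_partials_Ci_mult _ _ _ _ _ has_partials_flux)].
  apply locally_halfspace; [lra|]; intros; unfold flux2.
  rewrite weight_u, X2_u by assumption; ring.
Qed.

Lemma drift_defined_q0 : drift_defined (8 / 5) (u (8 / 5) 1) q0.
Proof.
  split; [|split; [|split; [|split]]].
  - apply locally_halfspace; [lra|].
    intros; eapply has_partials_ex; now apply has_partials_u.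
  - eapply has_partials_ex; exact has_partials_X1_u.
  - eapply has_partials_ex; exact has_partials_X2_u.
  - eapply has_partials_ex; exact has_partials_flux1.
  - eapply has_partials_ex; exact has_partials_flux2.
Qed.

Lemma drift_operator_q0 :
  drift_operator (8 / 5) 1 (u (8 / 5) 1) q0 = RtoC (- (3 / 8)).
Proof.
  unfold drift_operator, pLaplacian, bracket_X1_X2, q0.
  rewrite (has_partials_X1 _ _ _ _ _ _ _ has_partials_flux1).
  rewrite (has_partials_X2 _ _ _ _ _ _ _ has_partials_flux2).
  rewrite (has_partials_X1 _ _ _ _ _ _ _ has_partials_X2_u).
  rewrite (has_partials_X2 _ _ _ _ _ _ _ has_partials_X1_u).
  unfold RtoC, Ci, Cmult, Cplus, Cminus, Copp; simpl; f_equal; field.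
Qed.

Theorem theorem4p2 :
  exists p L : R,
    1 < p /\ p <> 4 /\
    exists q : H1,
      q <> H1_origin /\
      drift_defined p (u p L) q /\
      drift_operator p L (u p L) q <> RtoC 0.
Proof.
  exists (8 / 5), 1; split; [lra|]; split; [lra|].
  exists q0; split; [|split].
  - intros H; apply (f_equal (fun q : H1 => fst (fst q))) in H; simpl in H; lra.
  - exact drift_defined_q0.
  - rewrite drift_operator_q0; intros H.
    apply (f_equal Re) in H; simpl in H; lra.
Qed.
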